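(* Let $A$ be a basic finite dimensional algebra over a field $k$ with complete set of orthogonal primitive idempotents $1=e_1+\cdots+e_n$. For a subset $I\subset\{1,\ldots,n\}$ let $e:=\sum_{i\in I}e_i$. Then the isomorphism $K_0(\operatorname{proj}eAe)_{\mathbb R}\simeq K_0(\operatorname{proj}A)^I_{\mathbb R}$ induced by $-\otimes_{eAe}eA$ gives an isomorphism of fans $\Sigma(eAe)\simeq\Sigma^I(A)$.
   Context: In $\mathsf{K}^{\rm b}(\operatorname{proj}A)$, a 2-term presilting complex is a complex concentrated in degrees $-1,0$ with $\operatorname{Hom}(T,T[\ell])=0$ for $\ell>0$; $\mathrm{2\text{-}psilt}A$ is the set of isomorphism classes of basic ones. $K_0(\operatorname{proj}A)_{\mathbb R}=K_0(\mathsf{K}^{\rm b}(\operatorname{proj}A))\otimes\mathbb R$. For $T=T_1\oplus\cdots\oplus T_j\in\mathrm{2\text{-}psilt}A$ with $T_i$ indecomposable, $C(T)=\{\sum a_i[T_i]\mid a_i\ge0\}$; the $g$-fan is $\Sigma(A)=\{C(T)\mid T\in\mathrm{2\text{-}psilt}A\}$. $K_0(\operatorname{proj}A)^I_{\mathbb R}:=\bigoplus_{i\in I}\mathbb R[e_iA]$ and $\Sigma^I(A):=\{\sigma\in\Sigma(A)\mid\sigma\subset K_0(\operatorname{proj}A)^I_{\mathbb R}\}$. An isomorphism of fans is a lattice isomorphism whose linear extension maps cones bijectively to cones. *)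

(* Defs.v *)
From HB Require Import structures.
From mathcomp Require Import all_boot all_order all_algebra all_field.
From mathcomp Require Import classical_sets reals.
Set Implicit Arguments. Unset Strict Implicit. Unset Printing Implicit Defensive.
Import Order.TTheory GRing.Theory Num.Theory.
Local Open Scope ring_scope.
Local Open Scope classical_set_scope.

Section AlgHyp.
Variables (F : fieldType) (A : falgType F) (iota : finType) (f : iota -> A).

Definition orth_idems : Prop :=
  forall i j, f i * f j = if i == j then f i else 0.

Definition complete_idems : Prop := \sum_i f i = 1.

Definition primitive_idem (a : A) : Prop :=
  a != 0 /\ forall x, a * x * a = x -> x * x = x -> x = 0 \/ x = a.

(* e_i A ~= e_j A as right A-modules; Hom(e_i A, e_j A) = e_j A e_i *)
Definition proj_iso (i j : iota) : Prop :=
  exists u v, f j * u * f i = u /\ f i * v * f j = v /\ v * u = f i /\ u * v = f j.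

Definition basic_idems : Prop := forall i j, proj_iso i j -> i = j.
End AlgHyp.

(* proj B, for B with complete set of primitive orthogonal idempotents f_i,
   is modelled by finite direct sums (+)_k f_{s_k} B (s : seq iota); a morphism
   (+)_l f_{s_l} B -> (+)_k f_{t_k} B is a matrix with (k,l) entry in
   f_{t_k} B f_{s_l} = Hom(f_{s_l} B, f_{t_k} B), composition = matrix product. *)
Section TwoTerm.
Variables (F : fieldType) (A : falgType F) (iota : finType) (f : iota -> A).

Definition homP (t s : seq iota) (M : 'M[A]_(size t, size s)) : bool :=
  [forall k, forall l,
     f (tnth (in_tuple t) k) * M k l * f (tnth (in_tuple s) l) == M k l].

Definition idm (s : seq iota) : 'M[A]_(size s, size s) :=
  \matrix_(k, l) (if k == l then f (tnth (in_tuple s) k) else 0).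

(* a complex P1 --d--> P0 concentrated in degrees -1, 0 *)
Record cx := Cx {
  cx1 : seq iota;
  cx0 : seq iota;
  cxd : 'M[A]_(size cx0, size cx1);
  cxdP : homP cxd }.

Definition mor (X Y : cx) : Type :=
  ('M[A]_(size (cx1 Y), size (cx1 X)) * 'M[A]_(size (cx0 Y), size (cx0 X)))%type.

Definition mcomp (X Y Z : cx) (b : mor Y Z) (a : mor X Y) : mor X Z :=
  (b.1 *m a.1, b.2 *m a.2).
Definition madd (X Y : cx) (a b : mor X Y) : mor X Y := (a.1 + b.1, a.2 + b.2).
Definition mzero (X Y : cx) : mor X Y := (0, 0).
Definition mid (X : cx) : mor X X := (idm (cx1 X), idm (cx0 X)).

Definition chainmap (X Y : cx) (u : mor X Y) : Prop :=
  homP u.1 /\ homP u.2 /\ u.2 *m cxd X = cxd Y *m u.1.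

(* homotopic morphisms (equality in K^b(proj)) *)
Definition htp (X Y : cx) (u v : mor X Y) : Prop :=
  exists h : 'M[A]_(size (cx1 Y), size (cx0 X)),
    homP h /\ u.2 - v.2 = cxd Y *m h /\ u.1 - v.1 = h *m cxd X.

Definition iszero (X : cx) : Prop := htp (mid X) (mzero X X).

Definition biprod (X Y Z : cx) : Prop :=
  exists (iY : mor Y X) (pY : mor X Y) (iZ : mor Z X) (pZ : mor X Z),
    [/\ chainmap iY, chainmap pY, chainmap iZ & chainmap pZ] /\
    [/\ htp (mcomp pY iY) (mid Y), htp (mcomp pZ iZ) (mid Z),
        htp (mcomp pY iZ) (mzero Z Y), htp (mcomp pZ iY) (mzero Y Z) &
        htp (madd (mcomp iY pY) (mcomp iZ pZ)) (mid X)].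

Definition summand (Y X : cx) : Prop := exists Z, biprod X Y Z.

Definition indec (X : cx) : Prop :=
  ~ iszero X /\ forall Y Z, biprod X Y Z -> iszero Y \/ iszero Z.

Definition basic_cx (T : cx) : Prop :=
  forall Y Z, biprod T Y Z ->
  forall X, indec X -> summand X Y -> summand X Z -> False.

(* Hom_K(T, T[1]) = 0 : every g : P1 -> P0 is null-homotopic, i.e.
   g = d x + y d with x in End(P1), y in End(P0).
   (Hom(T, T[l]) = 0 automatically for l >= 2.) *)
Definition presilting (T : cx) : Prop :=
  forall g : 'M[A]_(size (cx0 T), size (cx1 T)), homP g ->
    exists (x : 'M[A]_(size (cx1 T), size (cx1 T)))
           (y : 'M[A]_(size (cx0 T), size (cx0 T))),
      [/\ homP x, homP y & g = cxd T *m x + y *m cxd T].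

(* class [T] = [P0] - [P1] in K_0(proj) = Z^iota *)
Definition gvec (X : cx) (i : iota) : int :=
  (count_mem i (cx0 X))%:Z - (count_mem i (cx1 X))%:Z.

Variable R : realType.

Definition gcone (T : cx) : set (iota -> R) :=
  [set v | exists (m : nat) (X : 'I_m -> cx) (a : 'I_m -> R),
     [/\ forall k, indec (X k) /\ summand (X k) T,
         forall k, 0 <= a k &
         v = fun i => \sum_(k < m) a k * (gvec (X k) i)%:~R]].

Definition gfan : set (set (iota -> R)) :=
  [set s | exists T, [/\ presilting T, basic_cx T & s = gcone T]].
End TwoTerm.

(* For I a set of indices, eAe (e = sum_{i in I} e_i) has complete set of
   primitive orthogonal idempotents e_i (i in I), indexed by the finType below,
   and Hom_{eAe}(e_j eAe, e_i eAe) = e_i (eAe) e_j = e_i A e_j. *)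
Definition subidx (n : nat) (I : {set 'I_n}) : finType := {i : 'I_n | i \in I}.

Definition sub_idems (F : fieldType) (A : falgType F) (n : nat)
  (e : 'I_n -> A) (I : {set 'I_n}) : subidx I -> A := fun x => e (val x).

(* K_0(proj eAe)_R -> K_0(proj A)^I_R  ( [e_i eAe] |-> [e_i A] ) *)
Definition embedI (R : realType) (n : nat) (I : {set 'I_n})
  (v : subidx I -> R) : 'I_n -> R :=
  fun i => oapp v 0 (insub i : option (subidx I)).

Definition K0I (R : realType) (n : nat) (I : {set 'I_n}) : set ('I_n -> R) :=
  [set v | forall i, i \notin I -> v i = 0].

Arguments sub_idems [F A n] e I _.
Arguments embedI [R n] I v _.
Arguments gfan [F A iota] f [R] _.

(* Main.v *)
Require Import Defs.
From HB Require Import structures.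
From mathcomp Require Import all_boot all_order all_algebra all_field.
From mathcomp Require Import classical_sets reals.
From mathcomp Require boolp.
From Stdlib Require Import Setoid Morphisms.
Set Implicit Arguments. Unset Strict Implicit. Unset Printing Implicit Defensive.
Import Order.TTheory GRing.Theory Num.Theory.
Local Open Scope ring_scope.
Local Open Scope classical_set_scope.

(** Since [e_i eAe e_j = e_i A e_j] for [i, j] in [I], a complex over [eAe] is
    the same thing as a complex over [A] all of whose labels lie in [I], and the
    two notions have the same morphisms and homotopies.  Because each [e_i A e_i]
    is local, Gaussian elimination makes every two-term complex homotopy
    equivalent to a reduced one (no entry of the differential is invertible),
    with the same [g]-vector because [A] is basic.  A reduced homotopy retract
    of [T] only involves labels of [T], in each degree; hence summands of
    complexes over [eAe] come from [eAe], which transports indecomposability,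
    basicness and cones.  Conversely, if [T] is presilting and reduced, its terms
    in degrees [0] and [-1] share no label: otherwise some [e_i] would be a sum
    of products with entries of the differential.  Splitting [T] into
    indecomposables, each label of [T] thus gives a nonzero coordinate of the
    [g]-vector of some summand, so a cone contained in [K_0^I] forces all labels
    into [I]. *)

(** * Corner rings of primitive idempotents *)

Section Local.
Variables (F : fieldType) (A : falgType F).
Implicit Types a x y z : A.

(** The powers of [x] up to the dimension of [A] are one too many to be linearly independent. *)
Lemma annihilating_poly x : exists2 p : {poly F}, p != 0 & horner_alg x p = 0.
Proof.
pose d := \dim {:A}.
pose X := [tuple x ^+ i | i < d.+1].
have : ~~ free X.
  apply/negP => /eqP fX; have := dimvS (subvf <<X>>%VS).
  by rewrite fX size_tuple ltnn.
move/freeP=> nf.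
have [k [c0 ck]] : exists k : 'I_d.+1 -> F,
    \sum_(i < d.+1) k i *: X`_i = 0 /\ exists i, k i != 0.
  apply: boolp.contrapT => H; apply: nf => k hk i; apply/eqP/negPn/negP => ki.
  by apply: H; exists k; split=> //; exists i.
exists (\poly_(i < d.+1) k (inord i)).
  case: ck => i ki; apply/eqP => /polyP /(_ i); rewrite coef_poly ltn_ord coef0 inord_val.
  by move/eqP; apply/negP.
rewrite poly_def raddf_sum /= -[RHS]c0; apply: eq_bigr => i _.
rewrite linearZ /= rmorphXn /= horner_algX inord_val mulr_algl; congr (_ *: _).
by rewrite (nth_map i) ?size_enum_ord // nth_ord_enum.
Qed.

(** Split the annihilating polynomial as [q * 'X^m] with [q.[0] != 0], and write [q = r * 'X +
    q.[0]]. Evaluating at [x] gives [x^m = x^m * (x * g)] with [g] a polynomial in [x], and this can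
    be iterated. *)
Lemma strongly_pi_regular x :
  exists m b, [/\ GRing.comm x b, (0 < m)%N & x ^+ m = x ^+ m * (x ^+ m * b)].
Proof.
have [p p0 px] := annihilating_poly x.
have [m [q /implyP /(_ p0) q0]] := multiplicity_XsubC p 0.
rewrite polyC0 subr0 => pE.
have [r qE] : exists r, q = r * 'X + q.[0]%:P.
  by have /factor_theorem [r rE] : root (q - q.[0]%:P) 0;
    [rewrite /root !hornerE subrr | exists r; rewrite polyC0 subr0 in rE; rewrite -rE subrK].
pose g : A := - (q.[0]^-1 *: horner_alg x r).
have cr : x * horner_alg x r = horner_alg x r * x.
  have : horner_alg x 'X * horner_alg x r = horner_alg x r * horner_alg x 'X.
    by rewrite -!rmorphM mulrC.
  by rewrite horner_algX.
have cxg : GRing.comm x g.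
  by rewrite /GRing.comm /g mulrN mulNr -scalerAr -scalerAl cr.
have xm : x ^+ m = x ^+ m * (x * g).
  have : (horner_alg x r * x + q.[0]%:A) * x ^+ m = 0.
    rewrite -px pE rmorphM rmorphXn /= horner_algX; congr (_ * _).
    by rewrite {2}qE rmorphD rmorphM /= horner_algX horner_algC.
  rewrite mulrDl -scalerAl mul1r => /eqP; rewrite addrC addr_eq0 => /eqP E.
  have cxm : GRing.comm (x * g) (x ^+ m).
    by apply: commrX; apply/commr_sym; apply: commrM.
  rewrite -cxm /g mulrN -scalerAr mulNr -scalerAl.
  by rewrite cr -scalerN -E scalerA mulVf ?scale1r.
have xmk k : x ^+ m = x ^+ m * (x * g) ^+ k.
  by elim: k => [|k IH]; rewrite ?mulr1 // exprS mulrA -xm.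
(* The exponent [m.+1] is positive even when [0] is not a root of [p]. *)
exists m.+1, (g ^+ m.+1); split=> //; first exact: commrX.
by rewrite -exprMn_comm // exprS -mulrA -xmk.
Qed.

Variable a : A.
Hypotheses (aa : a * a = a) (prim_a : primitive_idem a).

(** Fitting's lemma in [a A a]: for [y = x^m] as in [strongly_pi_regular], [y * b] is an idempotent
    of the corner, hence [0] or [a]. The first makes [x] nilpotent, the second yields an inverse. *)
Lemma corner_unit_or_nilpotent x : a * x * a = x ->
  (exists z, [/\ a * z * a = z, x * z = a & z * x = a]) \/ exists m, x ^+ m = 0.
Proof.
move=> ax; have [m [b [cxb m0 E]]] := strongly_pi_regular x.
have xl : a * x = x by rewrite -ax !mulrA aa.
have xr : x * a = x by rewrite -ax -!mulrA aa.
set y := x ^+ m in E.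
have yl : a * y = y by rewrite /y -(prednK m0) exprS mulrA xl.
have yr : y * a = y by rewrite /y -(prednK m0) exprSr -mulrA xr.
have cyb : y * b = b * y by apply/commr_sym; apply: commrX; apply/commr_sym.
have ya : a * (y * b) * a = y * b by rewrite mulrA yl cyb -mulrA yr.
have yy : y * b * (y * b) = y * b.
  by rewrite mulrA -[y * b * y]mulrA -cyb -E.
case: prim_a => _ /(_ _ ya yy) [y0|y1].
  by right; exists m; rewrite -/y E y0 mulr0.
have y1' : x * (x ^+ m.-1 * b) = a by rewrite mulrA -exprS prednK.
have y2' : (x ^+ m.-1 * b) * x = a.
  by rewrite -mulrA -cxb mulrA -exprSr prednK.
left; exists (a * (x ^+ m.-1 * b) * a); split.
- by rewrite !mulrA aa -!mulrA aa.
- by rewrite !mulrA xr -[x * _ * b]mulrA y1' aa.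
- by rewrite -!mulrA xl [_ * (b * x)]mulrA y2' aa.
Qed.

(** If [x] is nilpotent, a finite geometric series is a right inverse of [y = a * (1 - x)] relative
    to [a]. *)
Lemma corner_local x y : a * x * a = x -> a * y * a = y -> x + y = a ->
  (exists z, x * z = a) \/ (exists z, y * z = a).
Proof.
move=> ax ay xy; have [[z [_ xz _]]|[m xm]] := corner_unit_or_nilpotent ax.
  by left; exists z.
right; exists (\sum_(i < m) x ^+ i).
have -> : y = a * (1 - x).
  have xl : a * x = x by rewrite -ax !mulrA aa.
  by rewrite mulrBr mulr1 xl -[X in X - _]xy addrC addKr.
have := subrX1 x m; rewrite xm sub0r => E.
by rewrite -mulrA -[1 - x]opprB mulNr -E opprK mulr1.
Qed.

End Local.

(* For [x] in [e_i A e_j] with [e_i], [e_j] primitive, [rinv e_i x] says that [x]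
   is an isomorphism [e_j A -> e_i A]. *)
Definition rinv (R : pzRingType) (a x : R) : Prop := exists z, x * z = a.

(** * Isomorphisms between indecomposable projectives *)

Section Idempotents.
Variables (F : fieldType) (A : falgType F) (iota : finType) (f : iota -> A).
Hypotheses (orth_f : orth_idems f) (prim_f : forall i, primitive_idem (f i)).
Implicit Types x y z c : A.

Lemma idemf i : f i * f i = f i.
Proof. by rewrite orth_f eqxx. Qed.

Lemma rinvN a x : rinv a (- x) -> rinv a x.
Proof. by case=> z E; exists (- z); rewrite mulrN -mulNr. Qed.

Lemma rinv_mull a x y : rinv a (x * y) -> rinv a x.
Proof. by case=> z E; exists (y * z); rewrite mulrA. Qed.

Lemma not_rinv0 i : ~ rinv (f i) 0.
Proof.
by case=> z; rewrite mul0r => /esym /eqP; have [/negPf -> _] := prim_f i.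
Qed.

(** Right multiplication by [z * f i] moves both terms into the local ring [f i A f i]. *)
Lemma rinvD i x y : f i * x = x -> f i * y = y ->
  rinv (f i) (x + y) -> rinv (f i) x \/ rinv (f i) y.
Proof.
move=> xl yl [z E].
have [||||H] := @corner_local _ _ _ (idemf i) (prim_f i) (x * z * f i) (y * z * f i).
- by rewrite !mulrA xl -mulrA idemf.
- by rewrite !mulrA yl -mulrA idemf.
- by rewrite -mulrDl -mulrDl E idemf.
- by rewrite -mulrA => /rinv_mull; left.
- by rewrite -mulrA in H; right; apply: rinv_mull H.
Qed.

Lemma rinvB i x y : f i * x = x -> f i * y = y ->
  rinv (f i) (x - y) -> rinv (f i) x \/ rinv (f i) y.
Proof.
move=> xl yl /rinvD [//||H|/rinvN H]; [by rewrite mulrN yl|by left|by right].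
Qed.

Lemma rinv_sum i n (x : 'I_n -> A) : (forall k, f i * x k = x k) ->
  rinv (f i) (\sum_(k < n) x k) -> exists k, rinv (f i) (x k).
Proof.
elim: n x => [|n IH] x xl; first by rewrite big_ord0 => /not_rinv0.
rewrite big_ord_recl => /rinvD [||H|H].
- exact: xl.
- by rewrite mulr_sumr; apply: eq_bigr => k _; apply: xl.
- by exists ord0.
- by have [//|k Hk] := IH _ _ H; exists (lift ord0 k).
Qed.

Hypothesis basic_f : basic_idems f.

(** A right inverse [z'] makes [z' * x] an idempotent of [f j A f j], nonzero because
    [x * z' = f i]. Primitivity forces it to be [f j], and basicness then identifies the labels. *)
Lemma rinv_iso i j x : f i * x * f j = x -> rinv (f i) x ->
  j = i /\ exists z, [/\ f i * z * f i = z, x * z = f i & z * x = f i].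
Proof.
move=> xc [z xz]; pose z' := f j * z * f i.
have xr : x * f j = x by rewrite -xc -!mulrA idemf.
have xl : f i * x = x by rewrite -xc !mulrA idemf.
have xz' : x * z' = f i by rewrite /z' !mulrA xr xz idemf.
have z'l : f j * z' = z' by rewrite /z' !mulrA idemf.
have z'r : z' * f i = z' by rewrite /z' -!mulrA idemf.
have z'c : f j * z' * f i = z' by rewrite z'l z'r.
have z'x : z' * x = f j.
  have [_ /(_ (z' * x)) []//] := prim_f j.
  - by rewrite mulrA z'l -mulrA xr.
  - by rewrite mulrA -[z' * x * z']mulrA xz' z'r.
  move=> E; have [/eqP n0 _] := prim_f i; case: n0.
  have -> : f i = x * (z' * x) * z' by rewrite mulrA -mulrA xz' idemf.
  by rewrite E mulr0 mul0r.
have E : i = j by apply: basic_f; exists z', x; split=> //; split=> //.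
by subst j; split=> //; exists z'.
Qed.

(** The factor [c] is itself right invertible, so by [rinv_iso] it is an isomorphism with [i = j]
    and can be cancelled. *)
Lemma rinv_mulr i j l c x : f i * c * f j = c -> f j * x * f l = x ->
  rinv (f i) (c * x) -> rinv (f j) x.
Proof.
move=> cc xc H; have [ji [c' [c'c _ c'K]]] := rinv_iso cc (rinv_mull H).
case: H => z E; exists (z * c); subst j.
have xl : f i * x = x by rewrite -xc !mulrA idemf.
have cl : f i * c = c by rewrite -cc !mulrA idemf.
have -> : x * (z * c) = c' * (c * x * z) * c by rewrite !mulrA c'K xl.
by rewrite E -mulrA cl.
Qed.

End Idempotents.

(** * The homotopy category of two-term complexes *)

Section HomotopyCategory.
Variables (F : fieldType) (A : falgType F) (iota : finType) (f : iota -> A).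

Definition idt n (t : 'I_n -> iota) : 'M[A]_n :=
  \matrix_(k, l) if k == l then f (t k) else 0.

(** The entrywise condition of [homP] becomes invariance under two idempotent matrices, so that
    closure properties follow by matrix algebra. *)
Definition hom m n (t : 'I_m -> iota) (s : 'I_n -> iota) (M : 'M[A]_(m, n)) :=
  idt t *m M *m idt s == M.

Lemma mul_idt m n (t : 'I_m -> iota) (M : 'M[A]_(m, n)) k l :
  (idt t *m M) k l = f (t k) * M k l.
Proof.
rewrite mxE (bigD1 k) //= mxE eqxx big1 ?addr0 // => i /negPf ik.
by rewrite mxE eq_sym ik mul0r.
Qed.

Lemma mulr_idt m n (t : 'I_n -> iota) (M : 'M[A]_(m, n)) k l :
  (M *m idt t) k l = M k l * f (t l).
Proof.
rewrite mxE (bigD1 l) //= mxE eqxx big1 ?addr0 // => i /negPf ik.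
by rewrite mxE ik mulr0.
Qed.

Lemma homE m n (t : 'I_m -> iota) (s : 'I_n -> iota) (M : 'M[A]_(m, n)) :
  reflect (forall k l, f (t k) * M k l * f (s l) = M k l) (hom t s M).
Proof.
apply: (iffP eqP) => [/matrixP H k l|H]; first by rewrite -[RHS]H mulr_idt mul_idt.
by apply/matrixP=> k l; rewrite mulr_idt mul_idt H.
Qed.

Hypothesis orth_f : orth_idems f.

Lemma mul_idtt n (t : 'I_n -> iota) : idt t *m idt t = idt t.
Proof.
apply/matrixP=> k l; rewrite mul_idt mxE; case: eqP => _; last by rewrite mulr0.
by rewrite orth_f eqxx.
Qed.

Section Hom.
Variables (m n : nat) (t : 'I_m -> iota) (s : 'I_n -> iota).
Implicit Types M N : 'M[A]_(m, n).

Lemma homl M : hom t s M -> idt t *m M = M.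
Proof. by move/eqP=> <-; rewrite !mulmxA mul_idtt. Qed.

Lemma homr M : hom t s M -> M *m idt s = M.
Proof. by move/eqP=> <-; rewrite -!mulmxA mul_idtt. Qed.

Lemma homlE M k l : hom t s M -> f (t k) * M k l = M k l.
Proof. by move=> /homl H; rewrite -mul_idt H. Qed.

Lemma homrE M k l : hom t s M -> M k l * f (s l) = M k l.
Proof. by move=> /homr H; rewrite -mulr_idt H. Qed.

Lemma homI M : idt t *m M = M -> M *m idt s = M -> hom t s M.
Proof. by rewrite /hom => -> ->. Qed.

Lemma homD M N : hom t s M -> hom t s N -> hom t s (M + N).
Proof. by rewrite /hom => /eqP HM /eqP HN; rewrite mulmxDr mulmxDl HM HN. Qed.

Lemma homN M : hom t s M -> hom t s (- M).
Proof. by rewrite /hom => /eqP HM; rewrite mulmxN mulNmx HM. Qed.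

Lemma hom0 : hom t s 0.
Proof. by rewrite /hom mulmx0 mul0mx. Qed.

Lemma hom_idt : hom t t (idt t).
Proof. by rewrite /hom !mul_idtt. Qed.
End Hom.

Lemma homB m n (t : 'I_m -> iota) (s : 'I_n -> iota) (M N : 'M[A]_(m, n)) :
  hom t s M -> hom t s N -> hom t s (M - N).
Proof. by move=> HM HN; apply: homD => //; apply: homN. Qed.

Lemma homM m n p (t : 'I_m -> iota) (s : 'I_n -> iota) (r : 'I_p -> iota)
  (M : 'M[A]_(m, n)) (N : 'M[A]_(n, p)) :
  hom t s M -> hom s r N -> hom t r (M *m N).
Proof.
by move=> HM HN; apply: homI; rewrite ?mulmxA ?(homl HM) // -mulmxA (homr HN).
Qed.

(* As [cx], but the summands are indexed by an arbitrary map from ['I_n] rather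
   than by a sequence, so that no casts between ordinals are needed. *)
Record gcx := GCx {
  n1 : nat; n0 : nat;
  t1 : 'I_n1 -> iota; t0 : 'I_n0 -> iota;
  gd : 'M[A]_(n0, n1);
  gdP : hom t0 t1 gd }.

(** Bundling the chain map condition makes homotopy a setoid equality that rewrites under
    composition without side conditions. *)
Record hmor (X Y : gcx) := HMor {
  m1 : 'M[A]_(n1 Y, n1 X);
  m0 : 'M[A]_(n0 Y, n0 X);
  m1P : hom (@t1 Y) (@t1 X) m1;
  m0P : hom (@t0 Y) (@t0 X) m0;
  mC : m0 *m gd X = gd Y *m m1 }.

Definition heqv X Y (u v : hmor X Y) : Prop :=
  exists h : 'M[A]_(n1 Y, n0 X), [/\ hom (@t1 Y) (@t0 X) h,
    m0 u - m0 v = gd Y *m h & m1 u - m1 v = h *m gd X].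

Lemma heqv_eq X Y (u v : hmor X Y) : m1 u = m1 v -> m0 u = m0 v -> heqv u v.
Proof.
by move=> E1 E0; exists 0; rewrite hom0 E1 E0 !subrr mulmx0 mul0mx.
Qed.

Instance heqv_equiv X Y : Equivalence (@heqv X Y).
Proof.
split=> [u|u v [h [Hh E0 E1]]|u v w [h [Hh E0 E1]] [h' [Hh' E0' E1']]].
- exact: heqv_eq.
- exists (- h); rewrite homN // mulmxN mulNmx -E0 -E1 !opprB; split=> //.
- exists (h + h'); rewrite homD // mulmxDl mulmxDr -E0 -E1 -E0' -E1'.
  by split=> //; rewrite addrA subrK.
Qed.

Lemma heqv_refl X Y (u : hmor X Y) : heqv u u.
Proof. by reflexivity. Qed.
#[local] Hint Resolve heqv_refl : core.

Program Definition hid X : hmor X X := @HMor X X (idt (@t1 X)) (idt (@t0 X)) _ _ _.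
Next Obligation. by apply: hom_idt. Qed.
Next Obligation. by apply: hom_idt. Qed.
Next Obligation. by rewrite (homl (gdP _)) (homr (gdP _)). Qed.

Program Definition hcomp X Y Z (v : hmor Y Z) (u : hmor X Y) : hmor X Z :=
  @HMor X Z (m1 v *m m1 u) (m0 v *m m0 u) _ _ _.
Next Obligation. by apply: homM (m1P _) (m1P _). Qed.
Next Obligation. by apply: homM (m0P _) (m0P _). Qed.
Next Obligation. by rewrite -mulmxA mC !mulmxA mC. Qed.

Program Definition hadd X Y (u v : hmor X Y) : hmor X Y :=
  @HMor X Y (m1 u + m1 v) (m0 u + m0 v) _ _ _.
Next Obligation. by apply: homD (m1P _) (m1P _). Qed.
Next Obligation. by apply: homD (m0P _) (m0P _). Qed.
Next Obligation. by rewrite mulmxDl mulmxDr !mC. Qed.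

Program Definition hzero X Y : hmor X Y := @HMor X Y 0 0 _ _ _.
Next Obligation. by apply: hom0. Qed.
Next Obligation. by apply: hom0. Qed.
Next Obligation. by rewrite mul0mx mulmx0. Qed.

Local Notation "u =~ v" := (heqv u v) (at level 70).
Local Notation "v ** u" := (hcomp v u) (at level 40, left associativity).
Local Notation "u +~ v" := (hadd u v) (at level 50, left associativity).

Instance hcomp_proper X Y Z :
  Proper (@heqv Y Z ==> @heqv X Y ==> @heqv X Z) (@hcomp X Y Z).
Proof.
move=> v v' [h [Hh E0 E1]] u u' [k [Hk F0 F1]].
(* This follows the splitting [v u - v' u' = (v - v') u + v' (u - u')]. *)
exists (h *m m0 u + m1 v' *m k); split=> /=.
- by apply: homD; [apply: homM Hh (m0P _)|apply: homM (m1P _) Hk].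
- by rewrite mulmxDr !mulmxA -E0 -mC -[m0 v' *m _ *m _]mulmxA -F0 mulmxBl mulmxBr addrA subrK.
- by rewrite mulmxDl -!mulmxA -F1 mC [h *m _]mulmxA -E1 mulmxBl mulmxBr addrA subrK.
Qed.

Instance hadd_proper X Y :
  Proper (@heqv X Y ==> @heqv X Y ==> @heqv X Y) (@hadd X Y).
Proof.
move=> v v' [h [Hh E0 E1]] u u' [k [Hk F0 F1]].
by exists (h + k); rewrite homD // mulmxDl mulmxDr -E0 -E1 -F0 -F1 /= !opprD;
  split=> //; rewrite addrACA.
Qed.

Section Laws.
Variables X Y Z W : gcx.
Implicit Types (u : hmor X Y) (v : hmor Y Z) (w : hmor Z W).

Lemma hcompA u v w : w ** (v ** u) =~ w ** v ** u.
Proof. by apply: heqv_eq; rewrite /= mulmxA. Qed.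

Lemma hcomp1 u : u ** hid X =~ u.
Proof. by apply: heqv_eq; rewrite /= ?(homr (m1P _)) ?(homr (m0P _)). Qed.

Lemma hcomp1l u : hid Y ** u =~ u.
Proof. by apply: heqv_eq; rewrite /= ?(homl (m1P _)) ?(homl (m0P _)). Qed.

Lemma hcomp0 v : v ** hzero X Y =~ hzero X Z.
Proof. by apply: heqv_eq; rewrite /= mulmx0. Qed.

Lemma hcomp0l u : hzero Y Z ** u =~ hzero X Z.
Proof. by apply: heqv_eq; rewrite /= mul0mx. Qed.

Lemma hcompDr v u u' : v ** (u +~ u') =~ v ** u +~ v ** u'.
Proof. by apply: heqv_eq; rewrite /= mulmxDr. Qed.

Lemma hcompDl v v' u : (v +~ v') ** u =~ v ** u +~ v' ** u.
Proof. by apply: heqv_eq; rewrite /= mulmxDl. Qed.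

Lemma haddC u u' : u +~ u' =~ u' +~ u.
Proof. by apply: heqv_eq; rewrite /= addrC. Qed.

Lemma hadd0 u : u +~ hzero X Y =~ u.
Proof. by apply: heqv_eq; rewrite /= addr0. Qed.

Lemma hadd0l u : hzero X Y +~ u =~ u.
Proof. by apply: heqv_eq; rewrite /= add0r. Qed.

Lemma haddA u u' u'' : u +~ (u' +~ u'') =~ u +~ u' +~ u''.
Proof. by apply: heqv_eq; rewrite /= addrA. Qed.
End Laws.

Lemma hcompK X Y Z (a : hmor X Y) (b : hmor Y X) (u : hmor Z X) :
  b ** a =~ hid X -> b ** (a ** u) =~ u.
Proof. by move=> E; rewrite hcompA E hcomp1l. Qed.

Lemma hcomp0K X Y Z W (a : hmor X Y) (b : hmor Y Z) (u : hmor W X) :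
  b ** a =~ hzero X Z -> b ** (a ** u) =~ hzero W Z.
Proof. by move=> E; rewrite hcompA E hcomp0l. Qed.

Definition giszero X := hid X =~ hzero X X.

Definition gbiprod X Y Z := exists (iY : hmor Y X) (pY : hmor X Y)
  (iZ : hmor Z X) (pZ : hmor X Z),
  [/\ pY ** iY =~ hid Y, pZ ** iZ =~ hid Z, pY ** iZ =~ hzero Z Y,
      pZ ** iY =~ hzero Y Z & iY ** pY +~ iZ ** pZ =~ hid X].

Definition hiso X Y := exists (a : hmor X Y) (b : hmor Y X),
  a ** b =~ hid Y /\ b ** a =~ hid X.

Lemma hiso_refl X : hiso X X.
Proof. by exists (hid X), (hid X); rewrite hcomp1. Qed.

Lemma hiso_sym X Y : hiso X Y -> hiso Y X.
Proof. by case=> a [b [? ?]]; exists b, a. Qed.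

Lemma hiso_trans X Y Z : hiso X Y -> hiso Y Z -> hiso X Z.
Proof.
case=> a [b [E1 E2]] [c [d [E3 E4]]]; exists (c ** a), (b ** d).
by rewrite -!hcompA (hcompK _ E1) (hcompK _ E4).
Qed.

Lemma giszero_hiso X Y : hiso X Y -> giszero X -> giszero Y.
Proof.
case=> a [b [E1 E2]] z; rewrite /giszero -E1 -(hcomp1l b).
by rewrite /giszero in z; rewrite z hcomp0l hcomp0.
Qed.

Lemma gbiprod_sym X Y Z : gbiprod X Y Z -> gbiprod X Z Y.
Proof.
case=> iY [pY [iZ [pZ [? ? ? ? E]]]]; exists iZ, pZ, iY, pY; split=> //.
by rewrite haddC.
Qed.

Lemma gbiprod_hiso X X' Y Y' Z Z' :
  hiso X X' -> hiso Y Y' -> hiso Z Z' -> gbiprod X Y Z -> gbiprod X' Y' Z'.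
Proof.
case=> a [a' [a1 a2]] [b [b' [b1 b2]]] [c [c' [c1 c2]]].
case=> iY [pY [iZ [pZ [E1 E2 E3 E4 E5]]]].
exists (a ** iY ** b'), (b ** pY ** a'), (a ** iZ ** c'), (c ** pZ ** a').
split; rewrite -!hcompA.
- by rewrite (hcompK _ a2) (hcompK _ E1).
- by rewrite (hcompK _ a2) (hcompK _ E2).
- by rewrite (hcompK _ a2) (hcomp0K _ E3) hcomp0.
- by rewrite (hcompK _ a2) (hcomp0K _ E4) hcomp0.
- rewrite (hcompK _ b2) (hcompK _ c2) -hcompDr [iY ** _]hcompA [iZ ** _]hcompA.
  by rewrite -hcompDl E5 hcomp1l.
Qed.

(** This lets an abstract splitting be compared with the concrete [dsum], whose labels are known. *)
Lemma gbiprod_unique X X' Y Z : gbiprod X Y Z -> gbiprod X' Y Z -> hiso X X'.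
Proof.
case=> iY [pY [iZ [pZ [E1 E2 E3 E4 E5]]]].
case=> jY [qY [jZ [qZ [F1 F2 F3 F4 F5]]]].
exists (jY ** pY +~ jZ ** pZ), (iY ** qY +~ iZ ** qZ).
split; rewrite !hcompDl !hcompDr -!hcompA.
- rewrite (hcompK _ E1) (hcompK _ E2) (hcomp0K _ E3) (hcomp0K _ E4).
  by rewrite !hcomp0 hadd0 hadd0l.
- rewrite (hcompK _ F1) (hcompK _ F2) (hcomp0K _ F3) (hcomp0K _ F4).
  by rewrite !hcomp0 hadd0 hadd0l.
Qed.

(** Regrouping [(X + W) + Z] as [X + (W + Z)] is what makes being a summand transitive. *)
Lemma gbiprod_assoc T X Y Z W V :
  gbiprod T Y Z -> gbiprod Y X W -> gbiprod V W Z -> gbiprod T X V.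
Proof.
case=> iY [pY [iZ [pZ [E1 E2 E3 E4 E5]]]].
case=> iX [pX [iW [pW [F1 F2 F3 F4 F5]]]].
case=> jW [qW [jZ [qZ [G1 G2 G3 G4 G5]]]].
exists (iY ** iX), (pX ** pY), (iY ** iW ** qW +~ iZ ** qZ),
  (jW ** pW ** pY +~ jZ ** pZ).
split; rewrite ?hcompDl !(hcompDr, =^~ hcompA).
- by rewrite (hcompK _ E1).
- rewrite (hcompK _ E1) (hcompK _ E2) (hcompK _ F2).
  by rewrite (hcomp0K _ E3) (hcomp0K _ E4) !hcomp0 hadd0 hadd0l.
- by rewrite (hcompK _ E1) (hcomp0K _ E3) (hcomp0K _ F3) hcomp0 hadd0.
- by rewrite (hcompK _ E1) (hcomp0K _ E4) F4 !hcomp0 hadd0.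
- rewrite (hcompK _ G1) (hcompK _ G2) (hcomp0K _ G3) (hcomp0K _ G4).
  rewrite !hcomp0 hadd0 hadd0l haddA -hcompDr [iX ** _]hcompA [iW ** _]hcompA.
  by rewrite -hcompDl F5 hcomp1l.
Qed.


Lemma ord0_False (k : 'I_0) : False.
Proof. by case: k. Qed.

Definition gzero : gcx :=
  let t k := False_rect iota (ord0_False k) in GCx (hom0 t t).

Lemma giszero0 X : n0 X = 0%N -> n1 X = 0%N -> giszero X.
Proof.
case: X => m1 m0 t1 t0 d dP /= E0 E1; subst m1 m0.
by apply: heqv_eq; rewrite /= [LHS]flatmx0.
Qed.

Lemma gbiprod_gzero X : gbiprod X X gzero.
Proof.
exists (hid X), (hid X), (hzero gzero X), (hzero X gzero); split.
- by rewrite hcomp1.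
- by rewrite hcomp0; symmetry; apply: giszero0.
- by rewrite hcomp0.
- by rewrite hcomp0l.
- by rewrite hcomp1 hcomp0 hadd0.
Qed.

(** * Direct sums *)

Definition tcat m n (t : 'I_m -> iota) (s : 'I_n -> iota) (k : 'I_(m + n)) :=
  match split k with inl i => t i | inr j => s j end.

Lemma idt_tcat m n (t : 'I_m -> iota) (s : 'I_n -> iota) :
  idt (tcat t s) = block_mx (idt t) 0 0 (idt s).
Proof.
apply/matrixP=> k l; rewrite -(splitK k) -(splitK l).
case: (split k) (split l) => i [] j /=;
  rewrite ?block_mxEul ?block_mxEur ?block_mxEdl ?block_mxEdr !mxE.
- by rewrite eq_lshift /tcat (unsplitK (inl i)).
- by rewrite eq_lrshift.
- by rewrite eq_rlshift.
- by rewrite eq_rshift /tcat (unsplitK (inr i)).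
Qed.

Definition blockE := (mulmx_block, mul_block_col, mul_row_block, mul_row_col,
  mul_col_row, mul_mx_row, mul_col_mx, mul0mx, mulmx0, addr0, add0r, mul_idtt).

Section DirectSum.
Variables X Y : gcx.

Lemma dsumP : hom (tcat (@t0 X) (@t0 Y)) (tcat (@t1 X) (@t1 Y))
  (block_mx (gd X) 0 0 (gd Y)).
Proof.
by rewrite /hom !idt_tcat !blockE; rewrite !(homl (gdP _)) !(homr (gdP _)).
Qed.

Definition dsum : gcx := GCx dsumP.

Program Definition dinl : hmor X dsum :=
  @HMor X dsum (col_mx (idt (@t1 X)) 0) (col_mx (idt (@t0 X)) 0) _ _ _.
Next Obligation. by rewrite /hom !idt_tcat !blockE. Qed.
Next Obligation. by rewrite /hom !idt_tcat !blockE. Qed.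
Next Obligation. by rewrite !blockE (homl (gdP _)) (homr (gdP _)). Qed.

Program Definition dinr : hmor Y dsum :=
  @HMor Y dsum (col_mx 0 (idt (@t1 Y))) (col_mx 0 (idt (@t0 Y))) _ _ _.
Next Obligation. by rewrite /hom !idt_tcat !blockE. Qed.
Next Obligation. by rewrite /hom !idt_tcat !blockE. Qed.
Next Obligation. by rewrite !blockE (homl (gdP _)) (homr (gdP _)). Qed.

Program Definition dprl : hmor dsum X :=
  @HMor dsum X (row_mx (idt (@t1 X)) 0) (row_mx (idt (@t0 X)) 0) _ _ _.
Next Obligation. by rewrite /hom !idt_tcat !blockE. Qed.
Next Obligation. by rewrite /hom !idt_tcat !blockE. Qed.
Next Obligation. by rewrite !blockE (homl (gdP _)) (homr (gdP _)). Qed.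

Program Definition dprr : hmor dsum Y :=
  @HMor dsum Y (row_mx 0 (idt (@t1 Y))) (row_mx 0 (idt (@t0 Y))) _ _ _.
Next Obligation. by rewrite /hom !idt_tcat !blockE. Qed.
Next Obligation. by rewrite /hom !idt_tcat !blockE. Qed.
Next Obligation. by rewrite !blockE (homl (gdP _)) (homr (gdP _)). Qed.

Lemma gbiprod_dsum : gbiprod dsum X Y.
Proof.
exists dinl, dprl, dinr, dprr; split; apply: heqv_eq; rewrite /= ?idt_tcat !blockE //.
- by rewrite add_block_mx !blockE.
- by rewrite add_block_mx !blockE.
Qed.
End DirectSum.

(** * Homotopy invariance of presilting *)

Definition gpresilting X := forall g, hom (@t0 X) (@t1 X) g ->
  exists x y, [/\ hom (@t1 X) (@t1 X) x, hom (@t0 X) (@t0 X) y &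
                  g = gd X *m x + y *m gd X].

(** A map [g] on [Y] is carried to [X], decomposed there and carried back. The result differs from
    [g] by terms that the homotopy [h] from [a ** b] to the identity absorbs into [x] and [y]. *)
Lemma gpresilting_hiso X Y : hiso X Y -> gpresilting X -> gpresilting Y.
Proof.
case=> a [b [[h [Hh E0 E1]] _]] pX g Hg; rewrite /= in E0 E1.
have [|x [y [Hx Hy E]]] := pX (m0 b *m g *m m1 a).
  by apply: homM (homM (m0P b) Hg) (m1P a).
exists (m1 a *m x *m m1 b - h *m g *m (m1 a *m m1 b)),
       (m0 a *m y *m m0 b - g *m h).
split.
- apply: homB; first exact: homM (homM (m1P a) Hx) (m1P b).
  by apply: homM (homM Hh Hg) (homM (m1P a) (m1P b)).
- apply: homB; first exact: homM (homM (m0P a) Hy) (m0P b).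
  exact: homM Hg Hh.
have E' : m0 a *m (m0 b *m g *m m1 a) *m m1 b =
    gd Y *m (m1 a *m x *m m1 b) + m0 a *m y *m m0 b *m gd Y.
  rewrite E mulmxDr mulmxDl !mulmxA mC -!mulmxA; congr (_ + _).
  by rewrite -mC.
rewrite mulmxBr mulmxBl addrACA -E'.
rewrite !mulmxA -E0 -[g *m h *m _]mulmxA -E1 mulmxBl !mulmxBr !mulmxBl.
rewrite (homl Hg) (homr Hg) !mulmxA.
by rewrite !opprB addrA !subrKC.
Qed.

(** * Reduced complexes *)

Section Elimination.
Variables (a b : nat) (t0 : 'I_a.+1 -> iota) (t1 : 'I_b.+1 -> iota).
Variables (d : 'M[A]_(a.+1, b.+1)) (dP : hom t0 t1 d).
Variables (k : 'I_a.+1) (l : 'I_b.+1) (c : A).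
Hypotheses (cP : f (t1 l) * c * f (t0 k) = c).
Hypotheses (dc : d k l * c = f (t0 k)) (cd : c * d k l = f (t1 l)).

(** The inverse [c] of the pivot serves as a homotopy: [(pi1, pi0)] is the identity minus the
    boundary of [H]. Row [k] of [pi0] and column [l] of [pi1] vanish, so the pivot can be
    deleted. *)
Let H : 'M[A]_(b.+1, a.+1) := \matrix_(i, j) if (i == l) && (j == k) then c else 0.
Let pi0 := idt t0 - d *m H.
Let pi1 := idt t1 - H *m d.

Let HP : hom t1 t0 H.
Proof.
apply/homE => i j; rewrite mxE; case: eqP => [->|_]; last by rewrite mulr0 mul0r.
by case: eqP => [->|_] //=; rewrite mulr0 mul0r.
Qed.

Let mulH i j : (d *m H) i j = if j == k then d i l * c else 0.
Proof.
rewrite mxE (bigD1 l) //= mxE eqxx big1 => [|m /negPf ml]; last by rewrite mxE ml mulr0.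
by rewrite addr0 /=; case: eqP => // _; rewrite mulr0.
Qed.

Let Hmul i j : (H *m d) i j = if i == l then c * d k j else 0.
Proof.
rewrite mxE (bigD1 k) //= mxE eqxx andbT big1 => [|m /negPf ml].
  by rewrite addr0 /=; case: eqP => // _; rewrite mul0r.
by rewrite mxE ml andbF mul0r.
Qed.

Let pi0P : hom t0 t0 pi0.
Proof. by apply: homB (hom_idt _) (homM dP HP). Qed.

Let pi1P : hom t1 t1 pi1.
Proof. by apply: homB (hom_idt _) (homM HP dP). Qed.

Let pi0d : pi0 *m d = d *m pi1.
Proof. by rewrite mulmxBl mulmxBr mulmxA (homl dP) (homr dP). Qed.

Let pi0k j : pi0 k j = 0.
Proof.
by rewrite mxE [X in _ + X]mxE mulH mxE dc eq_sym; case: eqP; rewrite ?subr0 ?subrr.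
Qed.

Let pi1l i : pi1 i l = 0.
Proof.
rewrite mxE [X in _ + X]mxE Hmul mxE cd; case: eqP => [->|]; rewrite ?subr0 ?subrr //.
Qed.

Let colrow m n p (h : 'I_n.+1) (M : 'M[A]_(m, n.+1)) (N : 'M[A]_(n.+1, p)) :
  (forall i j, M i h * N h j = 0) ->
  colsub (lift h) M *m rowsub (lift h) N = M *m N.
Proof.
move=> E; apply/matrixP=> i j; rewrite !mxE (bigD1_ord h) //= E add0r.
by apply: eq_bigr => q _; rewrite !mxE.
Qed.

Let dpiP : hom t0 t1 (d *m pi1). Proof. exact: homM dP pi1P. Qed.

Let homsub m n m' n' (t : 'I_m -> iota) (s : 'I_n -> iota) (g : 'I_m' -> 'I_m)
  (h : 'I_n' -> 'I_n) (M : 'M[A]_(m, n)) :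
  hom t s M -> hom (t \o g) (s \o h) (mxsub g h M).
Proof. by move/homE=> E; apply/homE => i j; rewrite mxE E. Qed.

(** The differential is the Schur complement of the pivot, with entries
    [d i j - d i l * c * d k j]. *)
Let elim_cx : gcx := GCx (homsub (lift k) (lift l) dpiP).
Let orig_cx : gcx := GCx dP.

Let dsubE : gd elim_cx = rowsub (lift k) (colsub (lift l) (d *m pi1)).
Proof. by apply/matrixP=> i j; rewrite !mxE. Qed.

Let idtsub n m (t : 'I_n -> iota) (g : 'I_m -> 'I_n) : injective g ->
  mxsub g g (idt t) = idt (t \o g).
Proof. by move=> inj; apply/matrixP=> i j; rewrite !mxE (inj_eq inj). Qed.

Let to_elim : hmor orig_cx elim_cx.
Proof.
apply: (@HMor orig_cx elim_cx (rowsub (lift l) (idt t1)) (rowsub (lift k) pi0)).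
- exact: (homsub (lift l) id (hom_idt t1)).
- exact: (homsub (lift k) id pi0P).
- rewrite dsubE mul_rowsub_mx /= mul_rowsub_mx colrow => [|i j].
    by rewrite pi0d (homr dpiP).
  by rewrite [X in X * _]mxE big1 ?mul0r // => m _; rewrite pi1l mulr0.
Defined.

Let from_elim : hmor elim_cx orig_cx.
Proof.
apply: (@HMor elim_cx orig_cx (colsub (lift l) pi1) (colsub (lift k) (idt t0))).
- exact: (homsub id (lift l) pi1P).
- exact: (homsub id (lift k) (hom_idt t0)).
- rewrite dsubE colrow => [|i j].
    by rewrite mulmx_colsub (homl dpiP) mulmx_colsub.
  by rewrite -pi0d [X in _ * X]mxE [X in _ * X]mxE big1 ?mulr0 // => m _; rewrite pi0k mul0r.
Defined.

Lemma gauss_elimination :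
  exists d' (d'P : hom (t0 \o lift k) (t1 \o lift l) d'), hiso (GCx dP) (GCx d'P).
Proof.
exists (gd elim_cx), (gdP elim_cx), to_elim, from_elim; split.
- apply: heqv_eq => /=; rewrite mul_rowsub_mx mulmx_colsub ?(homl pi1P) ?(homr pi0P).
    rewrite -(idtsub _ (@lift_inj _ l)); apply/matrixP=> i j; rewrite 3!mxE.
    by rewrite [X in _ + X]mxE Hmul eq_sym (negPf (neq_lift _ _)) subr0 [RHS]mxE.
  rewrite -(idtsub _ (@lift_inj _ k)); apply/matrixP=> i j; rewrite 3!mxE.
  by rewrite [X in _ + X]mxE mulH eq_sym (negPf (neq_lift _ _)) subr0 [RHS]mxE.
(* This composite is [(pi1, pi0)], homotopic to the identity through [- H]; the other one equals the
   identity. *)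
- exists (- H); split; rewrite ?homN // /= colrow ?(homl pi0P) ?(homr pi1P).
  + by rewrite mulmxN addrC addKr.
  + by move=> i j; rewrite pi0k mulr0.
  + by rewrite mulNmx addrC addKr.
  + by move=> i j; rewrite pi1l mul0r.
Qed.

End Elimination.

Hypotheses (prim_f : forall i, primitive_idem (f i)) (basic_f : basic_idems f).

Definition cnt n (t : 'I_n -> iota) (i : iota) : nat := \sum_(k < n) (t k == i).

Definition ggvec X i : int := (cnt (@t0 X) i)%:Z - (cnt (@t1 X) i)%:Z.

(** By [rinv_iso] a right invertible entry is an isomorphism of indecomposables, so this is
    minimality of the complex: the differential is radical. *)
Definition reduced X := forall k l, ~ rinv (f (@t0 X k)) (gd X k l).

(** Induction on the number of labels in degree [0]: each invertible entry is eliminated. *)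
Lemma hiso_reduced X :
  exists Y, [/\ hiso X Y, reduced Y & ggvec X =1 ggvec Y].
Proof.
have [m] := ubnP (n0 X); elim: m X => // m IH X; rewrite ltnS => Xm.
have [rX|] := boolp.pselect (reduced X).
  by exists X; split=> //; apply: hiso_refl.
move/boolp.existsNP => [k /boolp.existsNP [l /boolp.contrapT]].
case: X k l Xm => b a t1 t0 d dP /= k l am kl.
case: a t0 d dP k kl am => [|a] t0 d dP k kl am; first by case: (ord0_False k).
case: b t1 d dP l kl => [|b] t1 d dP l kl; first by case: (ord0_False l).
have dkl : f (t0 k) * d k l * f (t1 l) = d k l by move/homE: dP.
have [tE [c [cP dc cd]]] := rinv_iso orth_f prim_f basic_f dkl kl.
have [|//||d' [d'P iso]] := @gauss_elimination _ _ _ _ _ dP k l c.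
- by rewrite tE.
- by rewrite cd tE.
have [|Y [isoY rY EY]] := IH (GCx d'P); first by rewrite /=.
exists Y; split=> //; first exact: hiso_trans iso isoY.
(* The two deleted labels coincide by [tE], so they cancel in the g-vector. *)
move=> i; rewrite -EY /ggvec /cnt /=.
rewrite (bigD1_ord k) //= [in X in _ - X](bigD1_ord l) //= tE !PoszD opprD addrACA.
by rewrite subrr add0r.
Qed.

Section Reduced.
Variable X : gcx.
Hypothesis redX : reduced X.

(** By locality a right invertible sum has a right invertible term, so radical matrices absorb
    multiplication. *)
Lemma reduced_dmul n (h : 'M[A]_(n1 X, n)) k l :
  ~ rinv (f (@t0 X k)) ((gd X *m h) k l).
Proof.
rewrite mxE => /(rinv_sum orth_f prim_f) [j|j /rinv_mull /redX //].
by rewrite mulrA (homlE _ _ (gdP X)).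
Qed.

Lemma reduced_muld n (s : 'I_n -> iota) (h : 'M[A]_(n, n0 X)) k l :
  hom s (@t0 X) h -> ~ rinv (f (s k)) ((h *m gd X) k l).
Proof.
move=> Hh; rewrite mxE => /(rinv_sum orth_f prim_f) [j|j].
  by rewrite mulrA (homlE _ _ Hh).
move/(rinv_mulr orth_f prim_f basic_f) => H; apply: (@redX j l); apply: H.
- by move/homE: Hh; apply.
- by move/homE: (gdP X); apply.
Qed.
End Reduced.

(** Locality applied to [f (t k)], the difference of the two diagonal entries, yields a right
    invertible term [p k j * q j k]. Then [p k j] is an isomorphism, so its labels agree. *)
Lemma mulmx_label m n (t : 'I_m -> iota) (s : 'I_n -> iota)
  (p : 'M[A]_(m, n)) (q : 'M[A]_(n, m)) k : hom t s p -> hom s t q ->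
  ~ rinv (f (t k)) ((p *m q - idt t) k k) ->
  exists j, s j = t k /\ rinv (f (t k)) (p k j).
Proof.
move=> Hp Hq nr.
have [] := @rinvB _ _ _ _ orth_f prim_f (t k) ((p *m q) k k) ((p *m q - idt t) k k).
- by rewrite (homlE _ _ (homM Hp Hq)).
- by rewrite (homlE _ _ (homB (homM Hp Hq) (hom_idt t))).
- rewrite [X in _ - X]mxE [X in _ - (_ + X)]mxE [X in _ - (_ - X)]mxE eqxx subKr.
  by exists (f (t k)); rewrite idemf.
- rewrite mxE => /(rinv_sum orth_f prim_f) [j|j /rinv_mull pj].
    by rewrite mulrA (homlE _ _ Hp).
  exists j; split=> //; have Hkj : f (t k) * p k j * f (s j) = p k j by move/homE: Hp.
  by have [-> _] := rinv_iso orth_f prim_f basic_f Hkj pj.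
- by move/nr.
Qed.

(* Exchange: each pivot of [p] is split off together with one row and one column. *)
Lemma mulmx_size_le m n (t : 'I_m -> iota) (s : 'I_n -> iota)
  (p : 'M[A]_(m, n)) (q : 'M[A]_(n, m)) : hom t s p -> hom s t q ->
  (forall k l, ~ rinv (f (t k)) ((p *m q - idt t) k l)) -> (m <= n)%N.
Proof.
elim: m n t s p q => // m IH [|n] t s p q Hp Hq nr;
  have [j [sj pj]] := mulmx_label Hp Hq (nr ord0 ord0).
  by case: (ord0_False j).
have Hkj : f (t ord0) * p ord0 j * f (s j) = p ord0 j by move/homE: Hp.
have [_ [c [cP pc cp]]] := rinv_iso orth_f prim_f basic_f Hkj pj.
(* Schur complement of the pivot [p ord0 j], whose inverse is [c]. *)
pose p' := \matrix_(k < m, l < n) (p (lift ord0 k) (lift j l)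
  - p (lift ord0 k) j * c * p ord0 (lift j l)).
have cr : c * f (t ord0) = c by rewrite -cP -!mulrA idemf.
have Hpk k l : f (t k) * p k l = p k l := homlE k l Hp.
have Hpr k l : p k l * f (s l) = p k l := homrE k l Hp.
apply: (IH n (t \o lift ord0) (s \o lift j) p' (mxsub (lift j) (lift ord0) q)).
- apply/homE => k l; rewrite mxE mulrBr mulrBl /= !mulrA !Hpk Hpr.
  by rewrite -[_ * p ord0 _ * _]mulrA Hpr.
- by move/homE: Hq => E; apply/homE => k l; rewrite mxE E.
move=> k l; have := nr (lift ord0 k) (lift ord0 l); have := nr ord0 (lift ord0 l).
set r := p *m q - idt t => n1 n2.
have Hr : hom t t r := homB (homM Hp Hq) (hom_idt t).
(* The new residual comes from [r] by the row operation that clears the pivot column, so a right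
   invertible entry would force one in [r]. *)
have -> : (p' *m mxsub (lift j) (lift ord0) q - idt (t \o lift ord0)) k l =
    r (lift ord0 k) (lift ord0 l) - p (lift ord0 k) j * c * r ord0 (lift ord0 l).
  rewrite [LHS]mxE [X in X + _]mxE [X in _ + X]mxE [X in _ - X]mxE.
  rewrite [r ord0 _]mxE [X in _ * (_ + X)]mxE [X in _ * (_ - X)]mxE /= subr0.
  rewrite [r _ _]mxE [X in _ = _ + X - _]mxE [X in _ = _ - X - _]mxE.
  rewrite (inj_eq (@lift_inj _ _)) addrAC; congr (_ - _).
  rewrite [in RHS]mxE (bigD1_ord j) //= [(p *m q) ord0 _]mxE (bigD1_ord j) //=.
  rewrite mulrDr mulrA -[_ * c * p _ _]mulrA cp -sj Hpr opprD addrA [X in X - _]addrC addKr.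
  rewrite mulr_sumr -sumrB; apply: eq_bigr => i _.
  by rewrite !mxE mulrBl !mulrA.
move/(rinvB orth_f prim_f) => [||/n2 //|].
- by rewrite (homlE _ _ Hr).
- by rewrite !mulrA Hpk.
move/(rinv_mulr orth_f prim_f basic_f) => H; apply: n1; apply: H.
- by rewrite !mulrA Hpk -mulrA cr.
- by move/homE: Hr; apply.
Qed.

Definition hretract X Y := exists (p : hmor Y X) (q : hmor X Y), p ** q =~ hid X.

(** The homotopy from [p ** q] to the identity lives on [X], so reducedness of [X] alone makes the
    error term radical. *)
Lemma hretract_label0 X Y k : reduced X -> hretract X Y ->
  exists j, @t0 Y j = @t0 X k.
Proof.
move=> rX [p [q [h [Hh E0 _]]]].
have [|j [? _]] := mulmx_label (k := k) (m0P p) (m0P q); last by exists j.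
by rewrite [_ - _]E0; apply: reduced_dmul.
Qed.

Lemma hretract_label1 X Y k : reduced X -> hretract X Y ->
  exists j, @t1 Y j = @t1 X k.
Proof.
move=> rX [p [q [h [Hh _ E1]]]].
have [|j [? _]] := mulmx_label (k := k) (m1P p) (m1P q); last by exists j.
by rewrite [_ - _]E1; apply: reduced_muld.
Qed.

Lemma hretract_size X Y : reduced X -> hretract X Y ->
  (n0 X <= n0 Y)%N /\ (n1 X <= n1 Y)%N.
Proof.
move=> rX [p [q [h [Hh E0 E1]]]]; split.
- apply: (mulmx_size_le (m0P p) (m0P q)) => k l.
  by rewrite [_ - _]E0; apply: reduced_dmul.
- apply: (mulmx_size_le (m1P p) (m1P q)) => k l.
  by rewrite [_ - _]E1; apply: reduced_muld.
Qed.

(** For a common label, the elementary matrix with entry [f (t0 k)] is a morphism; presilting would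
    write this idempotent as a sum of two radical entries. *)
Lemma presilting_disjoint X k l : reduced X -> gpresilting X -> @t0 X k <> @t1 X l.
Proof.
move=> rX pX kl.
pose g : 'M[A]_(n0 X, n1 X) :=
  \matrix_(i, j) if (i == k) && (j == l) then f (@t0 X k) else 0.
have [|x [y [Hx Hy /matrixP /(_ k l)]]] := pX g.
  apply/homE => i j; rewrite mxE; case: eqP => [->|_]; last by rewrite mulr0 mul0r.
  by case: eqP => [->|_]; rewrite ?mulr0 ?mul0r // -kl !idemf.
rewrite mxE !eqxx /= [RHS]mxE => E.
have [] := @rinvD _ _ _ _ orth_f prim_f (t0 k) ((gd X *m x) k l) ((y *m gd X) k l).
- by rewrite (homlE _ _ (homM (gdP X) Hx)).
- by rewrite (homlE _ _ (homM Hy (gdP X))).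
- by rewrite -E; exists (f (t0 k)); rewrite idemf.
- exact: reduced_dmul.
- exact: reduced_muld.
Qed.

Lemma reduced_dsum X Y : reduced X -> reduced Y -> reduced (dsum X Y).
Proof.
move=> rX rY k l; rewrite /= /tcat -(splitK k) -(splitK l) unsplitK.
case: (split k) (split l) => i [] j /=;
  rewrite ?block_mxEul ?block_mxEur ?block_mxEdl ?block_mxEdr ?mxE;
  by [apply: rX | apply: rY | apply: not_rinv0].
Qed.

(** * Indecomposable summands and their labels *)

Definition gindec X :=
  ~ giszero X /\ forall Y Z, gbiprod X Y Z -> giszero Y \/ giszero Z.

Definition gsummand Y X := exists Z, gbiprod X Y Z.

Lemma gsummand_trans X Y Z : gsummand X Y -> gsummand Y Z -> gsummand X Z.
Proof.
move=> [W YXW] [V ZYV]; exists (dsum W V).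
exact: gbiprod_assoc ZYV YXW (gbiprod_dsum W V).
Qed.

Lemma gsummand_refl X : gsummand X X.
Proof. by exists gzero; apply: gbiprod_gzero. Qed.

Lemma gsummand_hiso X X' Y Y' : hiso X X' -> hiso Y Y' -> gsummand X Y -> gsummand X' Y'.
Proof. by move=> hX hY [Z H]; exists Z; apply: gbiprod_hiso H => //; apply: hiso_refl. Qed.

Lemma gsummand_hretract X Y : gsummand X Y -> hretract X Y.
Proof. by case=> Z [i [p [_ [_ [? _ _ _ _]]]]]; exists p, i. Qed.

(** The boolean, [true] for degree [0] and [false] for degree [-1], lets both degrees share one
    statement. *)
Definition has_label (b : bool) X i :=
  if b then exists k, @t0 X k = i else exists k, @t1 X k = i.

Lemma hretract_label b X Y i : reduced X -> hretract X Y ->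
  has_label b X i -> has_label b Y i.
Proof.
case: b => rX rXY [k <-]; [exact: hretract_label0 | exact: hretract_label1].
Qed.

Lemma has_label_dsum b X Y i :
  has_label b (dsum X Y) i -> has_label b X i \/ has_label b Y i.
Proof.
by case: b => -[k]; rewrite /= /tcat; case: (split k) => j E; [left|right|left|right]; exists j.
Qed.

(** A contractible [X] is a retract of [gzero], which has no labels. *)
Lemma has_label_nonzero b X i : reduced X -> has_label b X i -> ~ giszero X.
Proof.
move=> rX lX zX; have /(hretract_label rX)/(_ lX) : hretract X gzero.
  exists (hzero gzero X), (hzero X gzero).
  by rewrite hcomp0; symmetry.
by case: b {lX} => -[k]; case: (ord0_False k).
Qed.

(** Induction on the number of labels. If [X] splits, reduced models [Y], [Z] of the two parts are
    nonempty, and [dsum Y Z], a reduced retract of [X], is no larger than [X]; so each part is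
    strictly smaller. Conversely [X] is a reduced retract of [dsum Y Z], so [i] occurs in one
    part. *)
Lemma indec_summand_label b X i : reduced X -> has_label b X i ->
  exists Y, [/\ gindec Y, gsummand Y X, reduced Y & has_label b Y i].
Proof.
have [m] := ubnP (n0 X + n1 X); elim: m X => // m IH X; rewrite ltnS => Xm rX lX.
have nzX := has_label_nonzero rX lX.
have [iX|] := boolp.pselect (gindec X).
  by exists X; split=> //; apply: gsummand_refl.
move=> /boolp.not_andP [//|/boolp.existsNP [Y0 /boolp.existsNP [Z0]]].
move/boolp.not_implyP => [XYZ0 /boolp.not_orP [nzY nzZ]].
have [Y [hY rY _]] := hiso_reduced Y0.
have [Z [hZ rZ _]] := hiso_reduced Z0.
have XYZ : gbiprod X Y Z := gbiprod_hiso (hiso_refl X) hY hZ XYZ0.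
have nz W W0 : hiso W0 W -> ~ giszero W0 -> (0 < n0 W + n1 W)%N.
  move=> hW nW; rewrite lt0n; apply/negP; rewrite addn_eq0 => /andP[/eqP E0 /eqP E1].
  by apply: nW; apply: giszero_hiso (hiso_sym hW) (giszero0 E0 E1).
have {nzY} nzY := nz _ _ hY nzY; have {nzZ} nzZ := nz _ _ hZ nzZ.
have [a [a' [aK a'K]]] := gbiprod_unique XYZ (gbiprod_dsum Y Z).
have [/= s0 s1] : (n0 (dsum Y Z) <= n0 X)%N /\ (n1 (dsum Y Z) <= n1 X)%N.
  by apply: hretract_size; [apply: reduced_dsum | exists a, a'].
have step W V : gbiprod X W V -> reduced W -> (n0 W + n1 W < m)%N -> has_label b W i ->
    exists Y, [/\ gindec Y, gsummand Y X, reduced Y & has_label b Y i].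
  move=> XWV rW Wm lW; have [U [iU sU rU lU]] := IH W Wm rW lW.
  by exists U; split=> //; apply: gsummand_trans sU _; exists V.
have : has_label b (dsum Y Z) i by apply: hretract_label lX => //; exists a', a.
have sz : (n0 Y + n1 Y + (n0 Z + n1 Z) <= m)%N.
  by rewrite addnACA; apply: leq_trans Xm; apply: leq_add.
case/has_label_dsum; apply: step => //.
- exact: XYZ.
- by apply: leq_trans sz; rewrite -[X in (X < _)%N]addn0 ltn_add2l.
- exact: gbiprod_sym XYZ.
- by apply: leq_trans sz; rewrite -[X in (X < _)%N]add0n ltn_add2r.
Qed.

Lemma gindec_hiso X Y : hiso X Y -> gindec X -> gindec Y.
Proof.
move=> hXY [nz iX]; split=> [zY|V W YVW].
  by apply: nz; apply: giszero_hiso (hiso_sym hXY) zY.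
by apply: iX; apply: gbiprod_hiso YVW; by [apply: hiso_sym | apply: hiso_refl].
Qed.

Definition gbasic T := forall Y Z, gbiprod T Y Z ->
  forall X, gindec X -> gsummand X Y -> gsummand X Z -> False.

Lemma gbasic_hiso T T' : hiso T T' -> gbasic T -> gbasic T'.
Proof.
move=> hT bT Y Z TYZ; apply: bT; apply: gbiprod_hiso TYZ;
  by [apply: hiso_sym | apply: hiso_refl].
Qed.

Lemma hretract_hiso X X' Y Y' : hiso X X' -> hiso Y Y' -> hretract X Y -> hretract X' Y'.
Proof.
move=> [a [b [ab ba]]] [c [d [cd dc]]] [p [q pq]].
exists (a ** p ** d), (c ** q ** b).
by rewrite -!hcompA (hcompK _ dc) (hcompK _ pq).
Qed.

Definition ggcone (R : realType) T : set (iota -> R) :=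
  [set v | exists (m : nat) (X : 'I_m -> gcx) (a : 'I_m -> R),
     [/\ forall k, gindec (X k) /\ gsummand (X k) T,
         forall k, 0 <= a k &
         v = fun i => \sum_(k < m) a k * (ggvec (X k) i)%:~R]].

Arguments ggcone : clear implicits.

Lemma ggcone_hiso (R : realType) T T' : hiso T T' -> ggcone R T = ggcone R T'.
Proof.
move=> hT; rewrite boolp.predeqE => v; split=> -[m [X [a [H a0 vE]]]]; exists m, X, a;
  (split=> // k; split; first by have [] := H k);
  apply: gsummand_hiso (H k).2; by [apply: hiso_refl | exact: hT | apply: hiso_sym].
Qed.

(** * Complexes with restricted labels *)

Section Relabel.
Variables (kappa : finType) (g : kappa -> iota).
Local Notation fg := (fun x => f (g x)).
Local Notation lab s := (fun k : 'I_(size s) => g (tnth (in_tuple s) k)).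

Lemma homPE (t s : seq kappa) (M : 'M[A]_(size t, size s)) :
  homP fg M = hom (lab t) (lab s) M.
Proof.
apply/idP/homE => [/forallP H k l|H]; first by have /forallP/(_ l)/eqP := H k.
by apply/forallP=> k; apply/forallP=> l; apply/eqP/H.
Qed.

Lemma gofP (X : cx fg) : hom (lab (cx0 X)) (lab (cx1 X)) (cxd X).
Proof. by rewrite -homPE; apply: cxdP. Qed.

(** The map [g] is arbitrary so that the same lemmas serve both algebras: the identity gives
    complexes over [A], the inclusion of [I] those over [eAe]. *)
Definition gof (X : cx fg) : gcx := GCx (gofP X).

(** Any labelling may be taken to be read off a sequence, as [cx] requires, without casting
    ordinals. *)
Lemma tnth_ind (P : forall n, ('I_n -> kappa) -> Prop) :
  (forall s : seq kappa, P (size s) (tnth (in_tuple s))) -> forall n t, P n t.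
Proof.
move=> H n t.
have -> : t = tnth [tuple t i | i < n] by apply: boolp.funext => i; rewrite tnth_mktuple.
case: [tuple t i | i < n] => s ns; have := H s; move: (ns); move/eqP: ns => ns.
by subst n => ns; rewrite (bool_irrelevance ns (eqxx _)).
Qed.

(** The conclusion is an equality, not just an equivalence, so properties of [G] transfer by
    rewriting. *)
Lemma gof_surj G : (forall k, exists x, g x = @t1 G k) ->
  (forall k, exists x, g x = @t0 G k) -> exists X, gof X = G.
Proof.
case: G => n1 n0 t1 t0 d dP /=.
move=> /fin_all_exists [l1 E1] /fin_all_exists [l0 E0].
have {E1} E1 : t1 = g \o l1 by apply: boolp.funext => k; rewrite /= E1.
have {E0} E0 : t0 = g \o l0 by apply: boolp.funext => k; rewrite /= E0.
subst t1 t0; move: n1 l1 d dP.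
apply: (@tnth_ind (fun n1 l1 => forall d dP,
  exists X, gof X = @GCx n1 n0 (g \o l1) (g \o l0) d dP)) => s1.
move: n0 l0; apply: (@tnth_ind (fun n0 l0 => forall d dP,
  exists X, gof X = @GCx (size s1) n0 (lab s1) (g \o l0) d dP)) => s0 d dP.
have dP' : homP fg d by rewrite homPE.
by exists (@Cx _ _ _ fg s1 s0 d dP'); rewrite /gof; congr GCx; apply: bool_irrelevance.
Qed.

Definition mor_of X Y (u : hmor (gof X) (gof Y)) : mor X Y := (m1 u, m0 u).

Lemma chainmap_mor_of X Y (u : hmor (gof X) (gof Y)) : chainmap (mor_of u).
Proof. by rewrite /chainmap !homPE; split; [exact: (m1P u)|split; [exact: (m0P u)|exact: (mC u)]]. Qed.

Lemma mor_of_surj X Y (u : mor X Y) : chainmap u ->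
  exists v : hmor (gof X) (gof Y), u = mor_of v.
Proof.
case: u => u1 u0; rewrite /chainmap !homPE => -[H1 [H0 E]].
by exists (@HMor (gof X) (gof Y) u1 u0 H1 H0 E).
Qed.

Lemma htpE X Y (u v : hmor (gof X) (gof Y)) : htp (mor_of u) (mor_of v) <-> u =~ v.
Proof.
split=> [[h [Hh [E0 E1]]]|[h [Hh E0 E1]]]; exists h.
  by rewrite homPE in Hh.
by rewrite homPE.
Qed.

Lemma iszeroE X : iszero X <-> giszero (gof X).
Proof. exact: (htpE (hid (gof X)) (hzero (gof X) (gof X))). Qed.

Lemma biprodE X Y Z : biprod X Y Z <-> gbiprod (gof X) (gof Y) (gof Z).
Proof.
split.
  move=> [iY [pY [iZ [pZ [[]]]]]].
  move=> /mor_of_surj [jY ->] /mor_of_surj [qY ->] /mor_of_surj [jZ ->] /mor_of_surj [qZ ->].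
  move=> [H1 H2 H3 H4 H5]; exists jY, qY, jZ, qZ; split.
  - exact/(htpE (qY ** jY) (hid _)).
  - exact/(htpE (qZ ** jZ) (hid _)).
  - exact/(htpE (qY ** jZ) (hzero _ _)).
  - exact/(htpE (qZ ** jY) (hzero _ _)).
  - exact/(htpE (jY ** qY +~ jZ ** qZ) (hid _)).
move=> [jY [qY [jZ [qZ [H1 H2 H3 H4 H5]]]]].
exists (mor_of jY), (mor_of qY), (mor_of jZ), (mor_of qZ).
split; split; try exact: chainmap_mor_of.
- exact/(htpE (qY ** jY) (hid _)).
- exact/(htpE (qZ ** jZ) (hid _)).
- exact/(htpE (qY ** jZ) (hzero _ _)).
- exact/(htpE (qZ ** jY) (hzero _ _)).
- exact/(htpE (jY ** qY +~ jZ ** qZ) (hid _)).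
Qed.

Lemma presiltingE X : presilting X <-> gpresilting (gof X).
Proof.
by split=> H h; [rewrite -homPE|rewrite homPE] => /H [x [y [Hx Hy E]]]; exists x, y;
  move: Hx Hy; rewrite !homPE.
Qed.

(* The complexes over [fg] are closed, up to homotopy equivalence, under retracts:
   a reduced retract only involves the labels of the ambient complex. *)
Lemma hretract_gof Y X : hretract Y (gof X) ->
  exists Y', hiso Y (gof Y') /\ ggvec Y =1 ggvec (gof Y').
Proof.
move=> rYX; have [Z [hYZ rZ EZ]] := hiso_reduced Y.
have rZX : hretract Z (gof X) := hretract_hiso hYZ (hiso_refl _) rYX.
have [||Y' EY'] := @gof_surj Z => [k|k|].
- by have [j <-] := hretract_label1 k rZ rZX; exists (tnth (in_tuple (cx1 X)) j).
- by have [j <-] := hretract_label0 k rZ rZX; exists (tnth (in_tuple (cx0 X)) j).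
by exists Y'; rewrite EY'.
Qed.

Lemma gsummand_gof Y X : gsummand Y (gof X) ->
  exists Y', hiso Y (gof Y') /\ ggvec Y =1 ggvec (gof Y').
Proof. by move/gsummand_hretract/hretract_gof. Qed.

(** The complement of [gof Y] need not a priori come from [fg]; being itself a summand of [gof X],
    it is equivalent to a complex that does. *)
Lemma summandE Y X : summand Y X <-> gsummand (gof Y) (gof X).
Proof.
split=> [[Z /biprodE]|[Z XYZ]]; first by exists (gof Z).
have [|Z' [hZ _]] := @gsummand_gof Z X; first by exists (gof Y); apply: gbiprod_sym.
by exists Z'; apply/biprodE; apply: gbiprod_hiso XYZ => //; apply: hiso_refl.
Qed.

Lemma gbiprod_gof X Y Z : gbiprod (gof X) Y Z -> exists Y' Z',
  [/\ hiso Y (gof Y'), hiso Z (gof Z') & biprod X Y' Z'].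
Proof.
move=> XYZ.
have [|Y' [hY _]] := @gsummand_gof Y X; first by exists Z.
have [|Z' [hZ _]] := @gsummand_gof Z X; first by exists Y; apply: gbiprod_sym.
exists Y', Z'; split=> //.
by apply/biprodE; apply: gbiprod_hiso XYZ => //; apply: hiso_refl.
Qed.

Lemma indecE X : indec X <-> gindec (gof X).
Proof.
split=> -[nz iX]; split.
- by move/iszeroE.
- move=> Y Z /gbiprod_gof [Y' [Z' [hY hZ /iX [] /iszeroE H]]]; [left|right];
  by apply: giszero_hiso H; apply: hiso_sym.
- by move/iszeroE.
- by move=> Y Z /biprodE /iX [] /iszeroE H; [left|right].
Qed.

Lemma basic_cxE T : basic_cx T <-> gbasic (gof T).
Proof.
split=> bT Y Z.
  move=> /gbiprod_gof [Y' [Z' [hY hZ TYZ]]] X iX XY XZ.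
  have [|X' [hX _]] := @gsummand_gof X Y'.
    exact: gsummand_hiso (hiso_refl X) hY XY.
  apply: (bT _ _ TYZ X'); first by apply/indecE; apply: gindec_hiso iX.
    by apply/summandE; apply: gsummand_hiso XY.
  by apply/summandE; apply: gsummand_hiso XZ.
by move=> /biprodE /bT H X /indecE iX /summandE XY /summandE XZ; apply: H XY XZ.
Qed.

Hypothesis inj_g : injective g.

Lemma count_lab (s : seq kappa) x : count_mem x s = cnt (lab s) (g x).
Proof.
rewrite -sum1_count big_tnth /cnt big_mkcond /=; apply: eq_bigr => k _.
by rewrite (inj_eq inj_g); case: eqP.
Qed.

Lemma gvecE X x : gvec X x = ggvec (gof X) (g x).
Proof. by rewrite /gvec !count_lab. Qed.

Lemma ggvec_gof_notin X i : (forall x, g x <> i) -> ggvec (gof X) i = 0.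
Proof.
move=> ni; rewrite /ggvec /cnt !big1 ?subrr // => k _ /=;
  by case: eqP => // /ni.
Qed.

Variable R : realType.

(** Each indecomposable summand of [gof T] is equivalent to a complex over [fg] with the same
    g-vector, so both cones have the same generators. *)
Lemma gconeE T : gcone T = (fun v : iota -> R => v \o g) @` ggcone R (gof T).
Proof.
rewrite boolp.predeqE => v; split.
  move=> [m [X [a [H a0 ->]]]].
  exists (fun i => \sum_(k < m) a k * (ggvec (gof (X k)) i)%:~R).
    exists m, (fun k => gof (X k)), a; split=> // k.
    by have [/indecE ? /summandE ?] := H k.
  by apply: boolp.funext => x /=; apply: eq_bigr => k _; rewrite gvecE.
move=> [_ [m [X [a [H a0 ->]]]] <-].
have /fin_all_exists [X' HX'] k := gsummand_gof (H k).2.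
exists m, X', a; split=> // [k|].
  have [iX sX] := H k; have [hX _] := HX' k.
  split; first by apply/indecE; apply: gindec_hiso iX.
  by apply/summandE; apply: gsummand_hiso sX => //; apply: hiso_refl.
apply: boolp.funext => x /=; apply: eq_bigr => k _.
by rewrite gvecE (HX' k).2.
Qed.

Lemma ggcone_notin T v i : ggcone R (gof T) v -> (forall x, g x <> i) -> v i = 0.
Proof.
move=> [m [X [a [H _ ->]]]] ni; apply: big1 => k _.
have [X' [_ ->]] := gsummand_gof (H k).2.
by rewrite (ggvec_gof_notin _ ni) mulr0.
Qed.
End Relabel.

(** Some indecomposable summand [Y] carries [i]. Labels of [Y] are labels of [T] in the same degree,
    so by [presilting_disjoint] [i] occurs in only one degree of [Y] and cannot cancel in its
    g-vector. *)
Lemma presilting_ggcone_label (R : realType) T i : reduced T -> gpresilting T ->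
  (exists b, has_label b T i) -> exists2 v, ggcone R T v & v i != 0.
Proof.
move=> rT pT [b lT]; have [Y [iY sY rY lY]] := indec_summand_label rT lT.
exists (fun j => (ggvec Y j)%:~R).
  exists 1%N, (fun=> Y), (fun=> 1); split=> //.
  by apply: boolp.funext => j; rewrite big_ord1 mul1r.
have YT := hretract_label rY (gsummand_hretract sY).
have cnt0 n (t : 'I_n -> iota) : (forall k, t k <> i) -> cnt t i = 0%N.
  by move=> nt; apply: big1 => k _; case: eqP => // /nt.
have cntN0 n (t : 'I_n -> iota) : (exists k, t k = i) -> cnt t i != 0%N.
  by move=> [k tk]; rewrite /cnt (bigD1 k) //= tk eqxx.
rewrite intr_eq0 /ggvec; case: b lT lY => -[k' k'i] lY.
  rewrite [cnt (@t1 _) _]cnt0 => [|k ki]; first by rewrite subr0; apply: cntN0.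
  have [l lk] := YT false i (ex_intro _ k ki).
  by case: (@presilting_disjoint T k' l) => //; rewrite k'i lk.
rewrite [cnt (@t0 _) _]cnt0 => [|k ki]; first by rewrite sub0r oppr_eq0; apply: cntN0.
have [l lk] := YT true i (ex_intro _ k ki).
by case: (@presilting_disjoint T l k') => //; rewrite k'i lk.
Qed.
End HomotopyCategory.

(** * Comparison of the two fans *)

Theorem theorem4p16 (F : fieldType) (A : falgType F) (n : nat) (e : 'I_n -> A)
  (I : {set 'I_n}) (R : realType) :
  orth_idems e -> complete_idems e -> (forall i, primitive_idem (e i)) ->
  basic_idems e ->
  forall s : set ('I_n -> R),
    (gfan (R:=R) e s /\ s `<=` K0I (R:=R) I) <->
    (exists t, gfan (R:=R) (sub_idems e I) t /\ s = embedI I @` t).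
Proof.
move=> orth _ prim basic s.
pose g (x : subidx I) : 'I_n := val x.
have inj_g : injective g := val_inj.
have inj_id : injective (@id 'I_n) by [].
have gP i : i \in I -> exists x, g x = i by move=> iI; exists (exist _ i iI).
have cone_id (T : cx e) : gcone T = ggcone orth (R := R) (gof (f := e) (g := id) T).
  rewrite (gconeE orth prim basic inj_id) boolp.predeqE => v.
  by split=> [[w Hw <-]|Hv] //; exists v.
have embedK v : K0I I v -> embedI I (v \o g) = v.
  move=> Hv; apply: boolp.funext => i; rewrite /embedI.
  by case: insubP => [x _ <-|/Hv ->].
(* [gconeE] describes the cone only after restriction to [I]; as the cone over [A] is supported on
   [I], extension by zero recovers it. *)
have cone_sub (T' : cx (sub_idems e I)) :
    embedI I @` gcone T' = ggcone orth (R := R) (gof (f := e) (g := g) T').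
  rewrite (gconeE orth prim basic inj_g) boolp.predeqE => v.
  have supp w : ggcone orth (R := R) (gof (f := e) (g := g) T') w -> K0I I w.
    move=> Hw i iI; apply: (ggcone_notin prim basic Hw) => x xi.
    by move: iI; rewrite -xi (valP x).
  split=> [[_ [w Hw <-] <-]|Hv]; first by rewrite embedK //; apply: supp.
  by exists (v \o g); [exists v | apply: embedK; apply: supp].
split.
  case=> -[T [pT bT ->]]; rewrite cone_id => sub.
  have [S [hS rS _]] := hiso_reduced orth prim basic (gof (f := e) (g := id) T).
  have pS : gpresilting S by apply: gpresilting_hiso hS _; apply/(presiltingE (f := e) (g := id)).
  (* A label outside [I] would give a vector of the cone with a nonzero coordinate there, against
     [sub]. *)
  have lS b i : has_label b S i -> exists x, g x = i.
    move=> lbl; apply: gP; apply/negPn/negP => iI.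
    have [|v Hv /negP[]] := presilting_ggcone_label orth prim basic R rS pS (i := i).
      by exists b.
    by rewrite (sub v) //; rewrite (ggcone_hiso R hS).
  (* With all its labels in [I], [S] is itself a complex over [eAe]. *)
  have [||T' ET'] := @gof_surj _ _ _ e _ g S => [k|k|].
  - by apply: (lS false); exists k.
  - by apply: (lS true); exists k.
  exists (gcone T'); split.
    exists T'; split=> //; first by apply/(presiltingE (f := e) (g := g)); rewrite ET'.
    apply/(basic_cxE orth prim basic (g := g)); rewrite ET'.
    by apply: gbasic_hiso hS _; apply/(basic_cxE orth prim basic (g := id)).
  by rewrite cone_sub ET'; apply: ggcone_hiso.
case=> _ [[T' [pT' bT' ->]] ->].
(* Conversely, [T'] is read as a complex over [A]; both have the same image under [gof], where
   presilting and basicness are tested. *)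
have [||T ET] := @gof_surj _ _ _ e _ id (gof (f := e) (g := g) T').
- by move=> k; eexists.
- by move=> k; eexists.
split.
  exists T; split.
  - by apply/(presiltingE (f := e) (g := id)); rewrite ET; apply/(presiltingE (f := e) (g := g)).
  - by apply/(basic_cxE orth prim basic (g := id)); rewrite ET; apply/(basic_cxE orth prim basic (g := g)).
  - by rewrite cone_sub cone_id ET.
move=> _ [v _ <-] i iI; rewrite /embedI insubF //.
exact: negPf.
Qed.
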